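(* Let $\mathrm T$ be an Archimedean $t$-norm and $\mathrm S$ an Archimedean $t$-conorm. If $\mathrm T$ is nilpotent or $\mathrm S$ is nilpotent, then the pair $(\mathrm T|_{\mathsf{Int}_{[0,1]}},\mathrm S|_{\mathsf{Int}_{[0,1]}})$ is not admissible.
   Context: Let $\mathsf{Int}_{[0,1]}=\{[a_1,a_2]: 0\le a_1\le a_2\le 1\}$ (degenerate intervals allowed); write $\mathbf u=[u_1,u_2]$. The interval order is: $\mathbf u\preceq_{\mathrm{Int}}\mathbf x$ iff $u_1\le x_1$ and $u_2\le x_2$. An admissible order is a total order $\preceq$ on $\mathsf{Int}_{[0,1]}$ such that $\mathbf u\preceq_{\mathrm{Int}}\mathbf x$ implies $\mathbf u\preceq\mathbf x$. An aggregation function (AF) is a function $\mathrm A\colon\mathsf{Int}_{[0,1]}\to[0,1]$ with $\mathrm A([0,0])=0$, $\mathrm A([1,1])=1$, and $\mathrm A(\mathbf u)\le\mathrm A(\mathbf x)$ whenever $u_1\le x_1$ and $u_2\le x_2$. For a pair $(\mathrm A,\mathrm B)$ of AFs, the relation $\preceq_{\mathrm A,\mathrm B}$ is defined by: $\mathbf u\preceq_{\mathrm A,\mathrm B}\mathbf x$ iff $\mathrm A(\mathbf u)<\mathrm A(\mathbf x)$, or $\mathrm A(\mathbf u)=\mathrm A(\mathbf x)$ and $\mathrm B(\mathbf u)\le\mathrm B(\mathbf x)$. The pair $(\mathrm A,\mathrm B)$ is admissible if $\preceq_{\mathrm A,\mathrm B}$ is an admissible order. For $\mathrm F\colon[0,1]^2\to[0,1]$,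 the restriction $\mathrm F|_{\mathsf{Int}_{[0,1]}}$ is the function $[x_1,x_2]\mapsto\mathrm F(x_1,x_2)$. A $t$-norm $\mathrm T\colon[0,1]^2\to[0,1]$ (commutative, associative, increasing in each argument, with neutral element $1$) is Archimedean if it is continuous and $\mathrm T(x,x)<x$ for all $x\in(0,1)$. Archimedean $t$-norms are exactly the functions $\mathrm T(a,b)=\mathrm t^{-1}\big(\min\{\mathrm t(a)+\mathrm t(b),\mathrm t(0)\}\big)$, where the additive generator $\mathrm t\colon[0,1]\to[0,\infty]$ is continuous and strictly decreasing with $\mathrm t(1)=0$; $\mathrm T$ is strict if $\mathrm t(0)=\infty$ and nilpotent if $\mathrm t(0)<\infty$. A $t$-conorm $\mathrm S\colon[0,1]^2\to[0,1]$ (commutative, associative, increasing in each argument, with neutral element $0$) is Archimedean if it is continuous and $\mathrm S(x,x)>x$ for all $x\in(0,1)$. Archimedean $t$-conorms are represented as $\mathrm S(a,b)=\mathrm s^{-1}\big(\min\{\mathrm s(a)+\mathrm s(b),\mathrm s(1)\}\big)$, where the additive generator $\mathrm s\colon[0,1]\to[0,\infty]$ is continuous and strictly increasing with $\mathrm s(0)=0$; $\mathrm S$ is strict if $\mathrm s(1)=\infty$ and nilpotent if $\mathrm s(1)<\infty$. *)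

(* Defs.v *)
From HB Require Import structures.
From mathcomp Require Import all_boot all_order all_algebra.
From mathcomp Require Import all_classical all_reals all_analysis.
Set Implicit Arguments.
Unset Strict Implicit.
Unset Printing Implicit Defensive.
Import Order.TTheory GRing.Theory Num.Theory.
Import numFieldNormedType.Exports.
Local Open Scope classical_set_scope.
Local Open Scope ring_scope.

(* Functions on [0,1] and [0,1]^2 are total functions on R and R^2; only their
   values on [0,1] and [0,1]^2 are constrained, and only those values matter. *)

Definition Int01 (R : realType) : Type :=
  {u : R * R | [&& 0 <= u.1, u.1 <= u.2 & u.2 <= 1]}.

Definition lo (R : realType) (u : Int01 R) : R := (val u).1.
Definition hi (R : realType) (u : Int01 R) : R := (val u).2.

Definition le_Int (R : realType) : rel (Int01 R) :=
  fun u x => (lo u <= lo x) && (hi u <= hi x).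

Definition admissible_order (R : realType) (r : rel (Int01 R)) : Prop :=
  [/\ reflexive r, antisymmetric r, transitive r, total r &
      forall u x, le_Int u x -> r u x].

Lemma bot_Int_subproof (R : realType) :
  [&& 0 <= ((0, 0) : R * R).1, ((0, 0) : R * R).1 <= ((0, 0) : R * R).2
    & ((0, 0) : R * R).2 <= 1].
Proof. by rewrite /= lexx ler01. Qed.

Lemma top_Int_subproof (R : realType) :
  [&& 0 <= ((1, 1) : R * R).1, ((1, 1) : R * R).1 <= ((1, 1) : R * R).2
    & ((1, 1) : R * R).2 <= 1].
Proof. by rewrite /= lexx ler01. Qed.

Definition bot_Int (R : realType) : Int01 R := exist _ (0, 0) (bot_Int_subproof R).
Definition top_Int (R : realType) : Int01 R := exist _ (1, 1) (top_Int_subproof R).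

Record AF (R : realType) := MkAF {
  AF_fun :> Int01 R -> R;
  AF_itv : forall u, AF_fun u \in `[0, 1];
  AF_bot : AF_fun (bot_Int R) = 0;
  AF_top : AF_fun (top_Int R) = 1;
  AF_mono : forall u x, lo u <= lo x -> hi u <= hi x -> AF_fun u <= AF_fun x
}.

Definition le_AB (R : realType) (A B : AF R) : rel (Int01 R) :=
  fun u x => (A u < A x) || ((A u == A x) && (B u <= B x)).

Definition admissible_pair (R : realType) (A B : AF R) : Prop :=
  admissible_order (le_AB A B).

Record tnorm (R : realType) := MkTnorm {
  tnorm_fun :> R -> R -> R;
  tnorm_itv : {in `[0, 1] &, forall x y, tnorm_fun x y \in `[0, 1]};
  tnormC : {in `[0, 1] &, commutative tnorm_fun};
  tnormA : {in `[0, 1] & &, associative tnorm_fun};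
  tnorm_monol : {in `[0, 1] & &, forall x y z,
    x <= y -> tnorm_fun x z <= tnorm_fun y z};
  tnorm_monor : {in `[0, 1] & &, forall x y z,
    x <= y -> tnorm_fun z x <= tnorm_fun z y};
  tnorm1 : {in `[0, 1], forall x, tnorm_fun x 1 = x}
}.

Record tconorm (R : realType) := MkTconorm {
  tconorm_fun :> R -> R -> R;
  tconorm_itv : {in `[0, 1] &, forall x y, tconorm_fun x y \in `[0, 1]};
  tconormC : {in `[0, 1] &, commutative tconorm_fun};
  tconormA : {in `[0, 1] & &, associative tconorm_fun};
  tconorm_monol : {in `[0, 1] & &, forall x y z,
    x <= y -> tconorm_fun x z <= tconorm_fun y z};
  tconorm_monor : {in `[0, 1] & &, forall x y z,
    x <= y -> tconorm_fun z x <= tconorm_fun z y};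
  tconorm0 : {in `[0, 1], forall x, tconorm_fun x 0 = x}
}.

Definition continuous01 (R : realType) (F : R -> R -> R) : Prop :=
  {within `[0, 1]%classic `*` `[0, 1]%classic,
    continuous (fun p : R * R => F p.1 p.2)}.

Definition archimedean_tnorm (R : realType) (T : tnorm R) : Prop :=
  continuous01 T /\ (forall x, 0 < x < 1 -> T x x < x).

Definition archimedean_tconorm (R : realType) (S : tconorm R) : Prop :=
  continuous01 S /\ (forall x, 0 < x < 1 -> x < S x x).

(* The inverse of a function [0,1] -> [0,+oo] that is injective on [0,1]. *)
Definition inv01 (R : realType) (t : R -> \bar R) : \bar R -> R :=
  'pinv_(fun=> 0) `[0, 1]%classic t.

Definition tnorm_generator (R : realType) (T : tnorm R) (t : R -> \bar R) :
  Prop :=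
  [/\ {in `[0, 1], forall x, (0 <= t x)%E},
      {within `[0, 1]%classic, continuous t},
      {in `[0, 1] &, forall x y, x < y -> (t y < t x)%E},
      t 1 = 0%E &
      {in `[0, 1] &, forall a b, T a b = inv01 t (mine (t a + t b)%E (t 0%R))}].

Definition tconorm_generator (R : realType) (S : tconorm R) (s : R -> \bar R) :
  Prop :=
  [/\ {in `[0, 1], forall x, (0 <= s x)%E},
      {within `[0, 1]%classic, continuous s},
      {in `[0, 1] &, forall x y, x < y -> (s x < s y)%E},
      s 0 = 0%E &
      {in `[0, 1] &, forall a b, S a b = inv01 s (mine (s a + s b)%E (s 1%R))}].

(* An additive generator is unique on [0,1] up to a positive factor, so it does
   not matter which generator is tested. *)
Definition nilpotent_tnorm (R : realType) (T : tnorm R) : Prop :=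
  exists t, tnorm_generator T t /\ (t 0%R < +oo)%E.

Definition nilpotent_tconorm (R : realType) (S : tconorm R) : Prop :=
  exists s, tconorm_generator S s /\ (s 1%R < +oo)%E.

Definition restrict_Int (R : realType) (F : R -> R -> R) : Int01 R -> R :=
  fun u => F (lo u) (hi u).

Lemma lo_itv (R : realType) (u : Int01 R) : lo u \in `[0, 1].
Proof.
case: u => -[a b] /= p; have /and3P[/= a0 ab b1] := p.
by rewrite in_itv /= /lo /= a0 (le_trans ab b1).
Qed.

Lemma hi_itv (R : realType) (u : Int01 R) : hi u \in `[0, 1].
Proof.
case: u => -[a b] /= p; have /and3P[/= a0 ab b1] := p.
by rewrite in_itv /= /hi /= b1 (le_trans a0 ab).
Qed.

Lemma zero_itv (R : realType) : (0 : R) \in `[0, 1].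
Proof. by rewrite in_itv /= lexx ler01. Qed.

Lemma one_itv (R : realType) : (1 : R) \in `[0, 1].
Proof. by rewrite in_itv /= lexx ler01. Qed.

Section restrictions.
Variables (R : realType) (T : tnorm R) (S : tconorm R).

Lemma tnorm_AF_itv (u : Int01 R) : restrict_Int T u \in `[0, 1].
Proof. exact: tnorm_itv (lo_itv u) (hi_itv u). Qed.

Lemma tnorm_AF_bot : restrict_Int T (bot_Int R) = 0.
Proof.
rewrite /restrict_Int /lo /hi /=; apply/le_anti/andP; split; last first.
  by have := tnorm_itv T (zero_itv R) (zero_itv R); rewrite in_itv => /andP[].
rewrite -[leRHS](tnorm1 T (zero_itv R)).
exact: tnorm_monor (zero_itv R) (one_itv R) (zero_itv R) ler01.
Qed.

Lemma tnorm_AF_top : restrict_Int T (top_Int R) = 1.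
Proof. exact: tnorm1 (one_itv R). Qed.

Lemma tnorm_AF_mono (u x : Int01 R) : lo u <= lo x -> hi u <= hi x ->
  restrict_Int T u <= restrict_Int T x.
Proof.
move=> l h.
apply: le_trans (tnorm_monol T (lo_itv u) (lo_itv x) (hi_itv u) l) _.
exact: tnorm_monor (hi_itv u) (hi_itv x) (lo_itv x) h.
Qed.

Definition tnorm_AF : AF R :=
  MkAF tnorm_AF_itv tnorm_AF_bot tnorm_AF_top tnorm_AF_mono.

Lemma tconorm_AF_itv (u : Int01 R) : restrict_Int S u \in `[0, 1].
Proof. exact: tconorm_itv (lo_itv u) (hi_itv u). Qed.

Lemma tconorm_AF_bot : restrict_Int S (bot_Int R) = 0.
Proof. exact: tconorm0 (zero_itv R). Qed.

Lemma tconorm_AF_top : restrict_Int S (top_Int R) = 1.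
Proof.
rewrite /restrict_Int /lo /hi /=; apply/le_anti/andP; split.
  by have := tconorm_itv S (one_itv R) (one_itv R); rewrite in_itv => /andP[].
rewrite -[leLHS](tconorm0 S (one_itv R)).
exact: tconorm_monor (zero_itv R) (one_itv R) (one_itv R) ler01.
Qed.

Lemma tconorm_AF_mono (u x : Int01 R) : lo u <= lo x -> hi u <= hi x ->
  restrict_Int S u <= restrict_Int S x.
Proof.
move=> l h.
apply: le_trans (tconorm_monol S (lo_itv u) (lo_itv x) (hi_itv u) l) _.
exact: tconorm_monor (hi_itv u) (hi_itv x) (lo_itv x) h.
Qed.

Definition tconorm_AF : AF R :=
  MkAF tconorm_AF_itv tconorm_AF_bot tconorm_AF_top tconorm_AF_mono.

End restrictions.

(* Main.v *)
Require Import Defs.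
From mathcomp Require Import all_boot all_order all_algebra.
From mathcomp Require Import all_classical all_reals all_analysis.

(**
If T(a, b) = 0 for some 0 < a <= b, put v = S(a, b). The distinct intervals
[a, b] and [0, v] have the same image 0 under T and the same image v under S,
so the preorder induced by (T, S) is not antisymmetric. Dually, if S(a, b) = 1
for some a <= b < 1, then [a, b] and [T(a, b), 1] are identified. A nilpotent T
admits such a pair with a = b: its generator t is continuous with
0 < t(0) < oo, so 2 t(a) >= t(0) for small a > 0; likewise for S near 1.
*)

Set Implicit Arguments.
Unset Strict Implicit.
Unset Printing Implicit Defensive.
Import Order.TTheory GRing.Theory Num.Theory.
Import numFieldNormedType.Exports.
Local Open Scope classical_set_scope.
Local Open Scope ring_scope.

Section generators.
Variable R : realType.
Implicit Types (t : R -> \bar R) (c : \bar R).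

(** The witness is half of [c]. Since [l < c] is strict, the values above [l] form an open
    neighbourhood of [c], which suits a continuity argument; [x] stays an extended real, so
    generator values need no finiteness proof. *)
Lemma half_lt_pos_fin c : (0 < c < +oo)%E ->
  exists2 l : \bar R, (l < c)%E & forall x, (l < x)%E -> (c <= x + x)%E.
Proof.
case: c => [c| |] //; rewrite ?ltxx ?andbF// lte_fin => /andP[c0 _].
exists (c / 2)%:E; first by rewrite lte_fin ltr_pdivrMr// mulr_natr mulr2n ltrDl.
move=> x lx; rewrite [c]splitr EFinD.
by apply: leeD; exact: ltW.
Qed.

Lemma in_itv01_oo (a : R) : 0 < a < 1 -> a \in `[0, 1].
Proof. by move=> /andP[a0 a1]; rewrite in_itv /= !ltW. Qed.

(** Continuity gives [l < t x] only for points of [0, 1] near [x0], and the point sought must avoid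
    both endpoints. A proper filter converging to [x0] and concentrated on (0, 1) supplies it; the
    one-sided neighbourhoods of 0 and of 1 are the two instances needed. *)
Lemma exists_gt_within01 t (l : \bar R) (F : set_system R) (x0 : R) :
  ProperFilter F -> F --> x0 -> (\forall x \near F, 0 < x < 1) ->
  x0 \in `[0, 1] -> {within `[0, 1], continuous t} -> (l < t x0)%E ->
  exists2 a, 0 < a < 1 & (l < t a)%E.
Proof.
move=> FF Fx0 F01 x0I /subspace_continuousP/(_ x0 x0I) tx0 lt0.
have near_x0 : \forall x \near x0, x \in `[0, 1] -> (l < t x)%E.
  exact: (tx0 _ (open_ereal_gt' lt0)).
have h : \forall x \near F, 0 < x < 1 /\ (l < t x)%E.
  apply: filterS2 F01 (Fx0 _ near_x0) => x x01 lx.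
  by split => //; apply: lx; exact: in_itv01_oo.
by have [a [a01 la]] := filter_ex h; exists a.
Qed.

Lemma exists_gt_near0 t (l : \bar R) :
  {within `[0, 1], continuous t} -> (l < t 0%R)%E ->
  exists2 a, 0 < a < 1 & (l < t a)%E.
Proof.
apply: (@exists_gt_within01 _ _ 0^'+); last exact: zero_itv.
- exact: cvg_within.
- near=> x; apply/andP; split; near: x; first exact: nbhs_right_gt.
  exact: nbhs_right_lt.
Unshelve. all: by end_near. Qed.

Lemma exists_gt_near1 t (l : \bar R) :
  {within `[0, 1], continuous t} -> (l < t 1%R)%E ->
  exists2 a, 0 < a < 1 & (l < t a)%E.
Proof.
apply: (@exists_gt_within01 _ _ 1^'-); last exact: one_itv.
- exact: cvg_within.
- near=> x; apply/andP; split; near: x; first exact: nbhs_left_gt.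
  exact: nbhs_left_lt.
Unshelve. all: by end_near. Qed.

(** A partial inverse picks some preimage in [0, 1]; injectivity there forces it to be [x]. *)
Lemma inv01K t : {in `[0, 1] &, injective t} ->
  {in `[0, 1], cancel t (inv01 t)}.
Proof.
move=> ti x x01; apply: pinvKV; last by rewrite mem_setE.
by move=> y z; rewrite !mem_setE; exact: ti.
Qed.

Lemma nilpotent_tnorm_zero_divisor (T : tnorm R) :
  nilpotent_tnorm T -> exists2 a, 0 < a < 1 & T a a = 0.
Proof.
move=> [t [[_ tc t_decr t1 TE] t0oo]].
have t0_gt0 : (0 < t 0%R)%E by rewrite -t1 t_decr// ?zero_itv ?one_itv.
have [l lt0 lP] : exists2 l, (l < t 0%R)%E & forall x, (l < x)%E -> (t 0%R <= x + x)%E.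
  by apply: half_lt_pos_fin; rewrite t0_gt0.
have [a a01 la] := exists_gt_near0 tc lt0; exists a => //.
(* As t(a) + t(a) >= t(0), the minimum is t(0), whose preimage is 0. What remains is injectivity of
   t, from strict monotonicity. *)
rewrite TE ?in_itv01_oo// min_r ?lP// inv01K ?zero_itv//.
move=> x y xI yI txy; have [xy|yx|//] := ltgtP x y.
- by have := t_decr _ _ xI yI xy; rewrite txy ltxx.
- by have := t_decr _ _ yI xI yx; rewrite txy ltxx.
Qed.

Lemma nilpotent_tconorm_one_divisor (S : tconorm R) :
  nilpotent_tconorm S -> exists2 a, 0 < a < 1 & S a a = 1.
Proof.
move=> [s [[_ sc s_incr s0 SE] s1oo]].
have s1_gt0 : (0 < s 1%R)%E by rewrite -s0 s_incr// ?zero_itv ?one_itv.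
have [l ls1 lP] : exists2 l, (l < s 1%R)%E & forall x, (l < x)%E -> (s 1%R <= x + x)%E.
  by apply: half_lt_pos_fin; rewrite s1_gt0.
have [a a01 la] := exists_gt_near1 sc ls1; exists a => //.
(* Here the sum is truncated at s(1), whose preimage is 1. *)
rewrite SE ?in_itv01_oo// min_r ?lP// inv01K ?one_itv//.
move=> x y xI yI sxy; have [xy|yx|//] := ltgtP x y.
- by have := s_incr _ _ xI yI xy; rewrite sxy ltxx.
- by have := s_incr _ _ yI xI yx; rewrite sxy ltxx.
Qed.

End generators.

Section not_admissible.
Variable R : realType.
Implicit Types (T : tnorm R) (S : tconorm R) (A B : AF R).

Lemma tnorm0l T : {in `[0, 1], forall x, T 0 x = 0}.
Proof.
move=> x xI; apply/le_anti/andP; split; last first.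
  by have := tnorm_itv T (zero_itv R) xI; rewrite in_itv => /andP[].
rewrite -[leRHS](tnorm1 T (zero_itv R)).
by apply: (tnorm_monor T xI (one_itv R) (zero_itv R)); rewrite (itvP xI).
Qed.

Lemma tconorm1r S : {in `[0, 1], forall x, S x 1 = 1}.
Proof.
move=> x xI; apply/le_anti/andP; split.
  by have := tconorm_itv S xI (one_itv R); rewrite in_itv => /andP[].
rewrite -[leLHS](tconorm0 S (one_itv R)) (tconormC S (one_itv R) (zero_itv R)).
by apply: (tconorm_monol S (zero_itv R) xI (one_itv R)); rewrite (itvP xI).
Qed.

Lemma mk_Int_subproof (a b : R) : 0 <= a -> a <= b -> b <= 1 ->
  [&& 0 <= (a, b).1, (a, b).1 <= (a, b).2 & (a, b).2 <= 1].
Proof. by move=> /= -> -> ->. Qed.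

Definition mk_Int (a b : R) (a0 : 0 <= a) (ab : a <= b) (b1 : b <= 1) : Int01 R :=
  exist _ (a, b) (mk_Int_subproof a0 ab b1).

(** Equal values under both functions make [u] and [x] related in both directions, so antisymmetry
    applies. One collision thus refutes admissibility. *)
Lemma admissible_pair_inj A B (u x : Int01 R) :
  admissible_pair A B -> A u = A x -> B u = B x -> u = x.
Proof.
by move=> [_ anti _ _ _] Aux Bux; apply: anti; rewrite /le_AB Aux Bux !eqxx !lexx !orbT.
Qed.

Lemma zero_divisor_not_admissible T S (a : R) : 0 < a < 1 -> T a a = 0 ->
  ~ admissible_pair (tnorm_AF T) (tconorm_AF S).
Proof.
move=> a01 Taa adm; have aI := in_itv01_oo a01.
have /andP[a0 a1] := a01.
have vI := tconorm_itv S aI aI.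
have v0 : 0 <= S a a by rewrite (itvP vI).
have v1 : S a a <= 1 by rewrite (itvP vI).
have := @admissible_pair_inj _ _ (mk_Int (ltW a0) (lexx a) (ltW a1))
  (mk_Int (lexx 0) v0 v1) adm.
(* With v = S(a, a), commutativity turns S(0, v) into S(v, 0) = v. The lower endpoints then give a =
   0. *)
rewrite /= /restrict_Int /lo /hi /= Taa tnorm0l// tconormC ?zero_itv//.
rewrite tconorm0// => /(_ erefl erefl) -[a_eq0 _].
by rewrite a_eq0 ltxx in a0.
Qed.

Lemma one_divisor_not_admissible T S (a : R) : 0 < a < 1 -> S a a = 1 ->
  ~ admissible_pair (tnorm_AF T) (tconorm_AF S).
Proof.
move=> a01 Saa adm; have aI := in_itv01_oo a01.
have /andP[a0 a1] := a01.
have vI := tnorm_itv T aI aI.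
have v0 : 0 <= T a a by rewrite (itvP vI).
have v1 : T a a <= 1 by rewrite (itvP vI).
have := @admissible_pair_inj _ _ (mk_Int (ltW a0) (lexx a) (ltW a1))
  (mk_Int v0 v1 (lexx 1)) adm.
(* With v = T(a, a), S(v, 1) = 1 and T(v, 1) = v; now the upper endpoints give a = 1. *)
rewrite /= /restrict_Int /lo /hi /= Saa tconorm1r// tnorm1//.
move=> /(_ erefl erefl) -[_ a_eq1].
by rewrite a_eq1 ltxx in a1.
Qed.

End not_admissible.

Theorem theorem4p11 (R : realType) (T : tnorm R) (S : tconorm R)
  (hT : archimedean_tnorm T) (hS : archimedean_tconorm S)
  (hnil : nilpotent_tnorm T \/ nilpotent_tconorm S) :
  ~ admissible_pair (tnorm_AF T) (tconorm_AF S).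
Proof.
case: hnil => [/nilpotent_tnorm_zero_divisor|/nilpotent_tconorm_one_divisor] [a a01].
- exact: zero_divisor_not_admissible.
- exact: one_divisor_not_admissible.
Qed.
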